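(* Let $k$ be an infinite field and let $R=k[x_1,\dots,x_n]/J$ be a standard graded Artinian $k$-algebra with homogeneous maximal ideal $\mathfrak m$. If $R$ enjoys the Weak Lefschetz Property and $\mu(\mathfrak m^2)\le\mu(\mathfrak m)$, then $\operatorname{ms}(R)\le1$. Conversely, if $\operatorname{ms}(R)\le1$, then $R$ enjoys the Weak Lefschetz Property and $\mu(\mathfrak m^{i+1})\le\mu(\mathfrak m^i)$ for all integers $i\ge1$.
   Context: $J$ is a proper homogeneous ideal and all variables have degree one; $[R]_i$ denotes the degree $i$ graded piece of $R$. For a homogeneous ideal $I$ of $R$, $\mu(I)=\dim_k(I/\mathfrak mI)$ is the minimal number of generators, and $$\operatorname{ms}(R)=\min\{\mu(I): I\subseteq \mathfrak m \text{ a homogeneous ideal with } I\supseteq \mathfrak m^2\}.$$ $R$ enjoys the Weak Lefschetz Property if for a general linear form $\ell\in[R]_1$ (that is, for all $\ell$ in some nonempty Zariski open subset of the $k$-vector space $[R]_1$), every multiplication map $\cdot\ell:[R]_i\to[R]_{i+1}$, $i\ge0$, has maximal rank, i.e. is injective or surjective. *)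

(* Defs.v *)
From HB Require Import structures.
From mathcomp Require Import all_boot all_order all_algebra.
From mathcomp Require Import generic_quotient ring_quotient.
From mathcomp Require Import boolp classical_sets functions cardinality.
From mathcomp Require Import mpoly.

Set Implicit Arguments.
Unset Strict Implicit.
Unset Printing Implicit Defensive.

Import GRing.Theory.
Local Open Scope classical_set_scope.
Local Open Scope ring_scope.
Local Open Scope quotient_scope.

(* ring_quotient provides only the commutative ring structure of a quotient;
   here the quotient of a commutative k-algebra receives the scalar action
   c *: \pi x = \pi (c *: x). *)
Section QuotientAlgebra.
Variables (k : fieldType) (A : comAlgType k) (I : idealr A).
Local Notation Q := {ideal_quot I}.

Definition quot_scale (c : k) (x : Q) : Q := \pi_Q (c *: 1) * x.

Lemma quot_scaleA a b v :
  quot_scale a (quot_scale b v) = quot_scale (a * b) v.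
Proof. by rewrite /quot_scale mulrA -rmorphM /= -scalerAl mul1r scalerA. Qed.

Lemma quot_scale1 : left_id 1 quot_scale.
Proof. by move=> v; rewrite /quot_scale scale1r rmorph1 mul1r. Qed.

Lemma quot_scaleDr : right_distributive quot_scale +%R.
Proof. by move=> a u v; rewrite /quot_scale mulrDr. Qed.

Lemma quot_scaleDl v : {morph quot_scale^~ v : a b / a + b}.
Proof. by move=> a b; rewrite /quot_scale scalerDl rmorphD mulrDl. Qed.

HB.instance Definition _ := GRing.Zmodule_isLmodule.Build k (Quotient.quot I)
  quot_scaleA quot_scale1 quot_scaleDr quot_scaleDl.

Lemma quot_scaleAl (a : k) (u v : Q) : a *: (u * v) = (a *: u) * v.
Proof. exact: mulrA. Qed.

HB.instance Definition _ :=
  GRing.Lmodule_isLalgebra.Build k (Quotient.quot I) quot_scaleAl.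
HB.instance Definition _ :=
  GRing.Lalgebra_isComAlgebra.Build k (Quotient.quot I).

Lemma quot_scaleE (c : k) (x : A) : c *: \pi_Q x = \pi_Q (c *: x).
Proof. by rewrite -[in RHS](mul1r x) scalerAl rmorphM. Qed.

End QuotientAlgebra.

Section Dimension.
Variables (k : fieldType) (V : lmodType k).
Implicit Types A B : set V.

(* e represents a k-basis of A / B, for subspaces B of A. *)
Definition basis_mod A B (d : nat) (e : 'I_d -> V) : Prop :=
  [/\ forall i, A (e i),
      forall c : 'I_d -> k, B (\sum_i c i *: e i) -> forall i, c i = 0
    & forall x, A x -> exists c : 'I_d -> k, B (x - \sum_i c i *: e i)].

(* dim_k (A / B), with the junk value 0 if it is infinite. *)
Definition dim_mod A B : nat :=
  xget 0%N [set d | exists e : 'I_d -> V, basis_mod A B e].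

(* Zariski open subsets of the finite-dimensional subspace A of V: in the
   coordinates of a basis of A, the points of A where some polynomial of a
   family S does not vanish. *)
Definition zariski_open A (U : set V) : Prop :=
  U `<=` A /\
  exists r (e : 'I_r -> V) (S : set {mpoly k[r]}), basis_mod A [set 0] e /\
    forall a : 'I_r -> k,
      U (\sum_i a i *: e i) <-> exists2 F, S F & F.@[a] != 0.

End Dimension.

Section Ideals.
Variables (k : fieldType) (A : comAlgType k).
Implicit Types I J : set A.

(* Unlike idealr_closed, this allows the unit ideal. *)
Definition is_ideal I : Prop :=
  I 0 /\ forall a x y, I x -> I y -> I (a * x + y).

Definition ideal_mul I J : set A :=
  smallest is_ideal [set z | exists x y, [/\ I x, J y & z = x * y]].

Fixpoint ideal_exp I (n : nat) : set A :=
  if n is n'.+1 then ideal_mul I (ideal_exp I n') else setT.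

Definition artinian : Prop :=
  forall I : nat -> set A,
    (forall n, is_ideal (I n)) -> (forall n, I n.+1 `<=` I n) ->
    exists N, forall n, (N <= n)%N -> I n = I N.

(* Homogeneity with respect to a grading gr of A: every element of I is a sum
   of homogeneous elements of I. *)
Definition homogeneous (gr : nat -> set A) I : Prop :=
  forall x, I x -> exists N (y : 'I_N -> A),
    (forall d : 'I_N, gr d (y d) /\ I (y d)) /\ x = \sum_d y d.

End Ideals.

(* The value 0 for empty P is junk. *)
Definition min_nat (P : set nat) : nat :=
  xget 0%N [set m | P m /\ forall n, P n -> (m <= n)%N].

Definition poly_degree (k : fieldType) (n d : nat) : set {mpoly k[n]} :=
  [set p | p \is d.-homog].

Section StandardGraded.
Variables (k : fieldType) (n : nat) (J : idealr {mpoly k[n]}).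
Local Notation R := {ideal_quot J}.

Definition grade (d : nat) : set R := \pi_R @` @poly_degree k n d.

Definition maxid : set R := smallest (@is_ideal k R) [set \pi_R 'X_i | i in setT].

Definition mu (I : set R) : nat := dim_mod I (ideal_mul maxid I).

Definition ms : nat :=
  min_nat [set mu I | I in [set I : set R |
    [/\ is_ideal I, homogeneous grade I, I `<=` maxid
      & ideal_exp maxid 2 `<=` I]]].

Definition maximal_rank (l : R) (i : nat) : Prop :=
  set_inj (grade i) ( *%R l) \/ set_surj (grade i) (grade i.+1) ( *%R l).

Definition weak_lefschetz : Prop :=
  exists U : set R,
    [/\ zariski_open (grade 1) U, U !=set0
      & forall l, U l -> forall i, maximal_rank l i].

End StandardGraded.

Arguments grade {k n} J d.
Arguments maxid {k n} J.

(* Main.v *)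
(* Both implications go through the condition: some linear form l satisfies
   [R]_2 = l [R]_1.  Since [R]_i maps isomorphically onto m^i / m^(i+1), the
   numbers mu(m^i) are the values of the Hilbert function.

   If mu(m^2) <= mu(m), a Lefschetz form that is injective on [R]_1 is also onto
   [R]_2 by dimension, and then m^2 is contained in (l), which needs at most one
   generator.

   Conversely, an ideal I with m^2 <= I <= m and mu(I) <= 1 produces such an l
   by comparing degrees.  The equality [R]_2 = l [R]_1 propagates to
   [R]_(i+1) = l [R]_i for all i >= 1, so mu(m^i) is nonincreasing, and it is an
   open condition on l; in degree 0 one only needs l != 0 (or [R]_1 = 0). *)
Require Import Defs.
From mathcomp Require Import all_boot all_order all_algebra.
From mathcomp Require Import generic_quotient ring_quotient.
From mathcomp Require Import boolp classical_sets functions cardinality.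
From mathcomp Require Import mpoly.

Set Implicit Arguments.
Unset Strict Implicit.
Unset Printing Implicit Defensive.

Import GRing.Theory.
Local Open Scope classical_set_scope.
Local Open Scope ring_scope.
Local Open Scope quotient_scope.

(** A member of [P] excludes the junk value of [min_nat], so the minimum is attained. *)
Lemma min_natP (P : set nat) m : P m ->
  P (min_nat P) /\ forall n, P n -> (min_nat P <= n)%N.
Proof.
move=> Pm; have exP : exists n, `[< P n >] by exists m; apply/asboolP.
suff : [set n | P n /\ forall n', P n' -> (n <= n')%N] (min_nat P) by [].
apply: xgetPex; case: (ex_minnP exP) => n /asboolP Pn nmin.
by exists n; split=> // n' /asboolP /nmin.
Qed.

(** * Linear algebra modulo a subspace *)

Section LinearAlgebraModulo.
Variables (k : fieldType) (V : lmodType k).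
Implicit Types A B W : set V.

Definition subspace W : Prop :=
  W 0 /\ forall c x y, W x -> W y -> W (c *: x + y).

Definition free_mod B d (e : 'I_d -> V) : Prop :=
  forall c : 'I_d -> k, B (\sum_i c i *: e i) -> forall i, c i = 0.

Definition span_mod B d (e : 'I_d -> V) : set V :=
  [set x | exists c : 'I_d -> k, B (x - \sum_i c i *: e i)].

Definition cons_fam d (x : V) (e : 'I_d -> V) (i : 'I_d.+1) : V :=
  if unlift ord0 i is Some j then e j else x.

Lemma subspaceZ W c x : subspace W -> W x -> W (c *: x).
Proof. by case=> W0 Wl Wx; rewrite -[_ *: x]addr0; apply: Wl. Qed.

Lemma subspaceD W x y : subspace W -> W x -> W y -> W (x + y).
Proof. by case=> W0 Wl Wx Wy; rewrite -[x]scale1r; apply: Wl. Qed.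

Lemma subspaceN W x : subspace W -> W x -> W (- x).
Proof. by move=> Ws Wx; rewrite -scaleN1r; apply: subspaceZ. Qed.

Lemma subspaceB W x y : subspace W -> W x -> W y -> W (x - y).
Proof. by move=> Ws Wx Wy; apply: subspaceD => //; apply: subspaceN. Qed.

Lemma subspace_sum W (I : Type) (r : seq I) (P : pred I) (F : I -> V) :
  subspace W -> (forall i, P i -> W (F i)) -> W (\sum_(i <- r | P i) F i).
Proof.
move=> Ws WF; apply: (big_ind W) => //; first by case: Ws.
by move=> x y; apply: subspaceD.
Qed.

Lemma sum_cons_fam d x (e : 'I_d -> V) (c : 'I_d.+1 -> k) :
  \sum_i c i *: cons_fam x e i =
  c ord0 *: x + \sum_i c (lift ord0 i) *: e i.
Proof.
rewrite big_ord_recl /cons_fam unlift_none; congr (_ + _).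
by apply: eq_bigr => i _; rewrite liftK.
Qed.

(** Modulo [B], the [e i] are combinations of the [s j] with coefficient matrix [A]. If q < p, a
    nonzero row [u] with u A = 0 gives a nontrivial relation among the [e i] modulo [B]. *)
Lemma free_mod_le B p q (e : 'I_p -> V) (s : 'I_q -> V) :
  subspace B -> free_mod B e -> (forall i, span_mod B s (e i)) -> (p <= q)%N.
Proof.
move=> Bs fe /choice[M MP]; rewrite leqNgt; apply/negP => ltqp.
pose A := \matrix_(i < p, j < q) M i j.
have : kermx A != 0.
  rewrite -mxrank_eq0 mxrank_ker subn_eq0 -ltnNge.
  by apply: leq_ltn_trans ltqp; apply: rank_leq_col.
case/rowV0Pn=> u /sub_kermxP uA /eqP; apply.
apply/rowP => i; rewrite mxE; apply: (fe (fun i => u 0 i)).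
rewrite (_ : \sum_i _ =
  \sum_i u 0 i *: (e i - \sum_j M i j *: s j)); last first.
  under [RHS]eq_bigr do rewrite scalerBr scaler_sumr.
  rewrite sumrB exchange_big /= [X in _ - X]big1 ?subr0 // => j _.
  under eq_bigr do rewrite scalerA.
  rewrite -scaler_suml; have /rowP/(_ j) := uA; rewrite !mxE.
  by under eq_bigr do rewrite mxE; move=> ->; rewrite scale0r.
by apply: subspace_sum => // j _; apply: subspaceZ.
Qed.

Lemma free_mod_cons B d (e : 'I_d -> V) x :
  subspace B -> free_mod B e -> ~ span_mod B e x -> free_mod B (cons_fam x e).
Proof.
move=> Bs fe nx c; rewrite sum_cons_fam => Bc.
have c0 : c ord0 = 0.
  apply/eqP/negPn/negP => c0; apply: nx.
  exists (fun i => - (c ord0)^-1 * c (lift ord0 i)).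
  under eq_bigr do rewrite -scalerA.
  rewrite -scaler_sumr scaleNr opprK.
  rewrite -[X in X + _](scalerK c0) -scalerDr.
  exact: subspaceZ.
move: Bc; rewrite c0 scale0r add0r => /fe cl i.
by case: (unliftP ord0 i) => [j ->|->].
Qed.

Lemma span_mod_subspace B d (e : 'I_d -> V) :
  subspace B -> subspace (span_mod B e).
Proof.
move=> Bs; split=> [|a x y [c Bx] [c' By]].
  exists (fun=> 0); rewrite big1 ?subrr => [|i _]; last by rewrite scale0r.
  by case: Bs.
exists (fun i => a * c i + c' i).
rewrite (_ : _ - _ = a *: (x - \sum_i c i *: e i) + (y - \sum_i c' i *: e i)).
  by case: Bs => _; apply.
under eq_bigr do rewrite scalerDl -scalerA.
by rewrite big_split /= -scaler_sumr scalerBr opprD addrACA.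
Qed.

Lemma sub_span_mod B d (e : 'I_d -> V) : B `<=` span_mod B e.
Proof.
move=> x Bx; exists (fun=> 0).
by rewrite big1 ?subr0 // => i _; rewrite scale0r.
Qed.

Lemma mem_span_mod B d (e : 'I_d -> V) i : subspace B -> span_mod B e (e i).
Proof.
move=> Bs; exists (fun j => (j == i)%:R).
rewrite (bigD1 i) //= eqxx scale1r big1 ?addr0 ?subrr; first by case: Bs.
by move=> j /negPf ->; rewrite scale0r.
Qed.

(** The bound on free families provides one of maximal size; it spans, since an element outside its
    span could be added to it. *)
Lemma basis_mod_exists A B N : subspace B ->
    (forall d (e : 'I_d -> V), (forall i, A (e i)) -> free_mod B e ->
       (d <= N)%N) ->
  exists d (e : 'I_d -> V), basis_mod A B e.
Proof.
move=> Bs bound.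
pose P d := `[< exists e : 'I_d -> V, (forall i, A (e i)) /\ free_mod B e >].
have exP : exists d, P d.
  exists 0; apply/asboolP; exists (fun i => 0).
  by split=> [[]|c _ []].
have leP d : P d -> (d <= N)%N.
  by move=> /asboolP[e [Ae fe]]; apply: (bound d e).
case: (ex_maxnP exP leP) => d /asboolP[e [Ae fe]] dmax.
exists d, e; split=> // x Ax; apply: contrapT => nx.
have /dmax : P d.+1; last by rewrite ltnn.
apply/asboolP; exists (cons_fam x e); split; last exact: free_mod_cons.
by move=> i; rewrite /cons_fam; case: (unlift _ _).
Qed.

Lemma basis_mod_size A B d d' (e : 'I_d -> V) (e' : 'I_d' -> V) :
  subspace B -> basis_mod A B e -> basis_mod A B e' -> d = d'.
Proof.
move=> Bs [Ae fe se] [Ae' fe' se']; apply/eqP; rewrite eqn_leq.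
apply/andP; split; first by apply: (free_mod_le Bs fe) => i; apply: se'.
by apply: (free_mod_le Bs fe') => i; apply: se.
Qed.

Lemma dim_modE A B d (e : 'I_d -> V) :
  subspace B -> basis_mod A B e -> dim_mod A B = d.
Proof.
move=> Bs be; apply: xget_unique; first by exists e.
by move=> d' [e' be']; apply: basis_mod_size be' be.
Qed.

(** Only a spanning family is required: if [A] modulo [B] had no finite basis, [dim_mod] would be 0
    and the bound would still hold. *)
Lemma dim_mod_le A B d (e : 'I_d -> V) :
  subspace B -> A `<=` span_mod B e -> (dim_mod A B <= d)%N.
Proof.
move=> Bs se; rewrite /dim_mod; case: xgetP => // d' _ [e' [Ae' fe' _]].
by apply: (free_mod_le Bs fe') => i; apply: se.
Qed.

(** An element outside the span of [f] would extend it to d' + 1 free vectors in a space spanned by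
    d <= d' vectors. *)
Lemma free_mod_spans A B d d' (e : 'I_d -> V) (f : 'I_d' -> V) :
    subspace B -> basis_mod A B e -> (forall i, A (f i)) -> free_mod B f ->
    (d <= d')%N ->
  A `<=` span_mod B f.
Proof.
move=> Bs [Ae fe se] Af ff led x Ax; apply: contrapT => nx.
have: (d'.+1 <= d)%N; last by rewrite ltnNge led.
apply: (free_mod_le Bs (free_mod_cons Bs ff nx)) => i; apply: se.
by rewrite /cons_fam; case: (unlift _ _).
Qed.

End LinearAlgebraModulo.

(** * Ideals, their products and powers *)

Section Ideals.
Variables (k : fieldType) (A : comAlgType k).
Implicit Types I : set A.

Lemma ideal_subspace I : is_ideal I -> subspace I.
Proof.
by case=> I0 Il; split=> // c x y Ix Iy; rewrite -[x]mul1r scalerAl; apply: Il.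
Qed.

Lemma idealM I a x : is_ideal I -> I x -> I (a * x).
Proof. by case=> I0 Il Ix; rewrite -[_ * _]addr0; apply: Il. Qed.

Lemma smallest_ideal (X : set A) : is_ideal (smallest (@is_ideal k A) X).
Proof.
split=> [I [[I0 _] _]|a x y Hx Hy I HI] //.
by case: (HI) => -[_ Il] _; apply: Il; [apply: Hx|apply: Hy].
Qed.

Lemma mem_ideal_mul I I' x y : I x -> I' y -> ideal_mul I I' (x * y).
Proof. by move=> Ix Iy; apply: sub_gen_smallest; exists x, y. Qed.

Lemma ideal_mul_sub (I I' K : set A) : is_ideal K ->
  (forall x y, I x -> I' y -> K (x * y)) -> ideal_mul I I' `<=` K.
Proof.
by move=> Ki IK; apply: smallest_sub => // _ [x [y [Ix Iy ->]]]; apply: IK.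
Qed.

Lemma ideal_exp_ideal I d : is_ideal (ideal_exp I d).
Proof. by case: d => [|d]; [split|apply: smallest_ideal]. Qed.

Lemma ideal_exp1 I : is_ideal I -> ideal_exp I 1 = I.
Proof.
move=> Ii; apply/seteqP; split=> [|x Ix].
  by apply: ideal_mul_sub => // x y Ix _; rewrite mulrC; apply: idealM.
by rewrite -[x]mulr1; apply: mem_ideal_mul.
Qed.

End Ideals.

(* The quotient by J is replaced by an arbitrary surjection pi from the
   polynomial ring whose kernel is, when needed, homogeneous. *)
Section GradedImage.
Variables (k : fieldType) (n : nat) (A : comAlgType k).
Variable pi : {rmorphism {mpoly k[n]} -> A}.
Hypothesis piZ : forall c p, pi (c *: p) = c *: pi p.
Hypothesis pi_surj : forall x, exists p, pi p = x.
Local Notation gr d := (pi @` @poly_degree k n d).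
Local Notation maxid := (smallest (@is_ideal k A) [set pi 'X_i | i in setT]).
Local Notation pow d := (ideal_exp maxid d).
Local Notation principal l := [set l%R * r | r in [set: A]]%R.
Implicit Types (p q : {mpoly k[n]}) (m : 'X_{1..n}) (x y l : A) (W : set A).

(** * Powers of the maximal ideal as images of polynomials of high order *)

Definition high_order d : set {mpoly k[n]} :=
  [set p | forall m, m \in msupp p -> (d <= mdeg m)%N].

Lemma high_orderX d m : (d <= mdeg m)%N -> high_order d 'X_[m].
Proof. by move=> dm m'; rewrite msuppX inE => /eqP ->. Qed.

Lemma high_orderM a b p q :
  high_order a p -> high_order b q -> high_order (a + b) (p * q).
Proof.
move=> hp hq m /msuppM_le /allpairsP[[m1 m2] /= [m1p m2q ->]].
by rewrite mdegD leq_add ?hp ?hq.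
Qed.

Lemma high_orderD d p q :
  high_order d p -> high_order d q -> high_order d (p + q).
Proof.
by move=> hp hq m /msuppD_le; rewrite mem_cat => /orP[/hp|/hq].
Qed.

Lemma high_order_ideal d : is_ideal (high_order d).
Proof.
split=> [m|a p q hp hq]; first by rewrite msupp0.
apply: high_orderD => //; rewrite -[d]add0n.
exact: high_orderM.
Qed.

Lemma pi_high_order_ideal d : is_ideal (pi @` high_order d).
Proof.
have [h0 hl] := high_order_ideal d.
split=> [|a _ _ [p hp <-] [q hq <-]]; first by exists 0; rewrite ?rmorph0.
have [a' <-] := pi_surj a.
by exists (a' * p + q); [apply: hl|rewrite rmorphD rmorphM].
Qed.

(** Reduces membership in a subspace to monomials; most inclusions below are proved this way. *)
Lemma pi_in_subspace W (P : pred 'X_{1..n}) p :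
  subspace W -> (forall m, P m -> W (pi 'X_[m])) ->
  {subset msupp p <= P} -> W (pi p).
Proof.
move=> Ws WX pP; rewrite [p]mpolyE rmorph_sum big_seq.
apply: subspace_sum => // m /pP /WX Wm.
by rewrite piZ; apply: subspaceZ.
Qed.

(** Induction on [a], moving one variable at a time from the second factor to the first. *)
Lemma mnm_split a b m : mdeg m = (a + b)%N ->
  exists m1 m2, [/\ m = (m1 + m2)%MM, mdeg m1 = a & mdeg m2 = b].
Proof.
elim: a m => [|a IH] m dm.
  by exists 0%MM, m; rewrite add0m mdeg0.
have [i mi] : exists i, m i != 0%N.
  apply/existsP; rewrite -[[exists _, _]]negbK negb_exists.
  apply/negP => /forallP m0; have : mdeg m = 0%N.
    by rewrite mdegE big1 // => i _; apply/eqP; rewrite -[_ == _]negbK m0.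
  by rewrite dm.
have Em : (m - U_(i) + U_(i))%MM = m by apply: submK; rewrite lep1mP.
have /IH[m1 [m2 [E d1 d2]]] : mdeg (m - U_(i)) = (a + b)%N.
  by move: dm; rewrite -{1}Em mdegD mdeg1 addn1 addSn => -[].
exists (U_(i) + m1)%MM, m2; split=> //; last by rewrite mdegD mdeg1 d1.
by rewrite -addmA -E addmC.
Qed.

Lemma piXD m1 m2 : pi 'X_[m1 + m2] = pi 'X_[m1] * pi 'X_[m2].
Proof. by rewrite mpolyXD rmorphM. Qed.

Lemma maxid_ideal : is_ideal (maxid).
Proof. exact: smallest_ideal. Qed.

Lemma maxidX m : (0 < mdeg m)%N -> maxid (pi 'X_[m]).
Proof.
case E: (mdeg m) => [//|d] _; move: E; rewrite -addn1.
case/mnm_split=> [m1 [m2 [-> _ /eqP/mdeg1P[i /eqP ->]]]].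
rewrite piXD; apply: (idealM _ maxid_ideal).
by apply: sub_gen_smallest; exists i.
Qed.

Lemma maxidE : maxid = pi @` high_order 1.
Proof.
apply/seteqP; split=> [|_ [p hp <-]].
  apply: smallest_sub; first exact: pi_high_order_ideal.
  by move=> _ [i _ <-]; exists 'X_i => //; apply: high_orderX; rewrite mdeg1.
apply: (@pi_in_subspace _ [pred m | (0 < mdeg m)%N]) hp => //.
  exact/ideal_subspace/maxid_ideal.
exact: maxidX.
Qed.

Lemma maxid_powX d m : (d <= mdeg m)%N -> pow d (pi 'X_[m]).
Proof.
elim: d m => [//|d IH] m; case E: (mdeg m) => [//|e] de.
case: (mnm_split (E : _ = 1 + e)%N) => [m1 [m2 [-> d1 d2]]].
rewrite piXD; apply: mem_ideal_mul; first by apply: maxidX; rewrite d1.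
by apply: IH; rewrite d2.
Qed.

(** Makes degree arguments available: an element of m^d can be lifted to a polynomial all of whose
    monomials have degree at least d. *)
Lemma maxid_powE d : pow d = pi @` high_order d.
Proof.
apply/seteqP; split=> [|_ [p hp <-]]; last first.
  apply: (@pi_in_subspace _ [pred m | (d <= mdeg m)%N]) hp => //.
    exact/ideal_subspace/ideal_exp_ideal.
  exact: maxid_powX.
elim: d => [x _|d IH]; first by have [p <-] := pi_surj x; exists p.
apply: ideal_mul_sub; first exact: pi_high_order_ideal.
move=> x y mx yd; have [q hq <-] := IH _ yd.
move: mx; rewrite maxidE => -[p hp <-].
by exists (p * q); [rewrite -add1n; apply: high_orderM|rewrite rmorphM].
Qed.

Lemma maxid_pow_subspace d : subspace (pow d).
Proof. exact/ideal_subspace/ideal_exp_ideal. Qed.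

Lemma maxid_pow_le a b : (a <= b)%N -> pow b `<=` pow a.
Proof.
move=> ab; rewrite !maxid_powE => _ [p hp <-]; exists p => // m /hp.
exact: leq_trans.
Qed.

Lemma maxid_powM a b x y : pow a x -> pow b y -> pow (a + b) (x * y).
Proof.
rewrite !maxid_powE => -[p hp <-] [q hq <-].
by exists (p * q); [apply: high_orderM|rewrite rmorphM].
Qed.

Lemma maxid_pow1 : pow 1 = maxid.
Proof. exact/ideal_exp1/maxid_ideal. Qed.

(** The finitely many monomials of degree below [d] span modulo m^d, because all others map into
    m^d. *)
Lemma finite_mod_maxid_pow d :
  exists N (s : 'I_N -> A), forall x, span_mod (pow d) s x.
Proof.
pose s (i : 'I_#|{: 'X_{1..n < d}}|) := pi 'X_[bmnm (enum_val i)].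
have ds := maxid_pow_subspace d.
exists #|{: 'X_{1..n < d}}|, s => x; have [p <-] := pi_surj x.
apply: (@pi_in_subspace _ predT) => // [|m _]; first exact: span_mod_subspace.
have [lt_md|le_dm] := ltnP (mdeg m) d; last exact/sub_span_mod/maxid_powX.
have := mem_span_mod s (enum_rank (BMultinom lt_md)) ds.
by rewrite {2}/s enum_rankK.
Qed.

Lemma basis_mod_maxid_pow d (I K : set A) :
  subspace K -> pow d `<=` K -> exists r (e : 'I_r -> A), basis_mod I K e.
Proof.
move=> Ks dK; have [N [s sP]] := finite_mod_maxid_pow d.
apply: (basis_mod_exists (N := N)) => // r e _ fe.
apply: (free_mod_le Ks fe (s := s)) => i.
by have [c /dK] := sP (e i); exists c.
Qed.

(** * Graded pieces and homogeneous components *)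

Lemma grade_subspace d : subspace (gr d).
Proof.
split=> [|c _ _ [p hp <-] [q hq <-]].
  by exists 0; [apply: dhomog0|rewrite rmorph0].
exists (c *: p + q); last by rewrite rmorphD piZ.
by apply: rpredD => //; apply: rpredZ.
Qed.

Lemma gradeM a b x y : gr a x -> gr b y -> gr (a + b) (x * y).
Proof.
by move=> [p hp <-] [q hq <-]; exists (p * q); [apply: dhomogM|rewrite rmorphM].
Qed.

Lemma grade_sub_subspace W d : subspace W ->
  (forall m, mdeg m = d -> W (pi 'X_[m])) -> gr d `<=` W.
Proof.
move=> Ws WX _ [p /dhomogP hp <-].
apply: (@pi_in_subspace _ [pred m | mdeg m == d]) => // m.
  by move=> /eqP/WX.
by move=> /hp/eqP.
Qed.

Lemma gradeX m : gr (mdeg m) (pi 'X_[m]).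
Proof. by exists 'X_[m] => //; rewrite /poly_degree /= dhomogX. Qed.

Lemma grade_sub_pow d : gr d `<=` pow d.
Proof.
apply: grade_sub_subspace; first exact: maxid_pow_subspace.
by move=> m dm; apply: maxid_powX; rewrite dm.
Qed.

Lemma grade0E x : gr 0 x -> exists c : k, x = c *: 1.
Proof.
move: x; apply: grade_sub_subspace => [|m /eqP].
  split=> [|a _ _ [c ->] [c' ->]]; first by exists 0; rewrite scale0r.
  by exists (a * c + c'); rewrite scalerDl scalerA.
rewrite mdeg_eq0 => /eqP ->; exists 1.
by rewrite scale1r mpolyX0 rmorph1.
Qed.

Lemma grade_exp_sub_ideal d (I : set A) :
  is_ideal I -> gr d `<=` I -> pow d `<=` I.
Proof.
move=> Ii dI; rewrite maxid_powE => _ [p hp <-].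
apply: (@pi_in_subspace _ [pred m | (d <= mdeg m)%N]) hp.
  exact: ideal_subspace.
move=> m /= dm; have : mdeg m = ((mdeg m - d) + d)%N by rewrite subnK.
case/mnm_split=> [m1 [m2 [-> _ d2]]].
by rewrite piXD; apply: (idealM _ Ii); apply: dI; rewrite -d2; apply: gradeX.
Qed.

Lemma high_order_pihomog d i p :
  high_order d p -> high_order d (pihomog mdeg i p).
Proof.
have hs := ideal_subspace (high_order_ideal d).
move=> hp; rewrite pihomogE big_seq_cond; apply: subspace_sum => // m.
by move=> /andP[/hp dm _]; apply: (subspaceZ _ hs); apply: high_orderX.
Qed.

Lemma high_order_sub_pihomog d p :
  high_order d p -> high_order d.+1 (p - pihomog mdeg d p).
Proof.
have hs := ideal_subspace (high_order_ideal d.+1).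
move=> hp; rewrite pihomogE {1}[p]mpolyE (bigID (fun m => mdeg m == d)) /=.
rewrite addrAC subrr add0r big_seq_cond; apply: subspace_sum => // m.
move=> /andP[/hp dm md]; apply: (subspaceZ _ hs); apply: high_orderX.
by rewrite ltn_neqAle eq_sym md.
Qed.

(** Splits off the component of lowest degree d of a lift of order at least d. *)
Lemma maxid_pow_decomp d x :
  pow d x -> exists2 y, gr d y & pow d.+1 (x - y).
Proof.
rewrite !maxid_powE => -[p hp <-].
exists (pi (pihomog mdeg d p)).
  by exists (pihomog mdeg d p) => //; apply: pihomogP.
exists (p - pihomog mdeg d p); first exact: high_order_sub_pihomog.
by rewrite rmorphB.
Qed.

Lemma maxid_pow_homogeneous d : homogeneous (fun d => gr d) (pow d).
Proof.
rewrite maxid_powE => _ [p hp <-].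
exists (mmeasure mdeg p), (fun i => pi (pihomog mdeg i p)); split=> [i|].
  split; first by exists (pihomog mdeg i p) => //; apply: pihomogP.
  by exists (pihomog mdeg i p) => //; apply: high_order_pihomog.
by rewrite {1}(pihomog_partitionE (leqnn (mmeasure mdeg p))) rmorph_sum.
Qed.

(** * Principal ideals *)

Lemma principal_ideal l : is_ideal (principal l).
Proof.
split=> [|a _ _ [r _ <-] [s _ <-]]; first by exists 0; rewrite ?mulr0.
by exists (a * r + s); rewrite // mulrDr mulrCA.
Qed.

Lemma principal_homogeneous d l : gr d l ->
  homogeneous (fun d => gr d) (principal l).
Proof.
move=> dl _ [r _ <-]; have [p <-] := pi_surj r.
(* The component of degree i of the product is [l] times the component of degree i - d of [p]. The
   test on [i] is needed because the truncated difference would be 0 for i < d. *)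
exists (d + mmeasure mdeg p)%N, (fun i : 'I__ =>
  if (d <= i)%N then l * pi (pihomog mdeg (i - d) p) else 0).
split=> [i|].
  case: leqP => di; last first.
    split; first by case: (grade_subspace i).
    by exists 0; rewrite ?mulr0.
  split; last by exists (pi (pihomog mdeg (i - d) p)).
  rewrite -{1}(subnKC di); apply: gradeM => //.
  by exists (pihomog mdeg (i - d) p) => //; apply: pihomogP.
rewrite big_split_ord /= big1 ?add0r => [|i _]; last by rewrite leqNgt ltn_ord.
rewrite {1}(pihomog_partitionE (leqnn (mmeasure mdeg p))) rmorph_sum mulr_sumr.
by apply: eq_bigr => i _; rewrite leq_addr addKn.
Qed.

(** * Comparison of degrees when the kernel is homogeneous *)

Section HomogeneousIdeal.
Hypothesis pi_hom : forall d p, pi p = 0 -> pi (pihomog mdeg d p) = 0.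

(** Lift [x] to a form [p] of degree d and to a polynomial [q] of order above d. The component of
    degree d of p - q is [p], and homogeneity of the kernel sends it to 0. *)
Lemma grade_pow_eq0 d x : gr d x -> pow d.+1 x -> x = 0.
Proof.
rewrite maxid_powE => -[p hp <-] [q hq Eqp].
rewrite -[RHS](pi_hom d (p := p - q)); last first.
  by rewrite rmorphB Eqp subrr.
rewrite raddfB /= pihomog_dE // pihomogE big_seq_cond big1 ?subr0 // => m.
by move=> /andP[/hq dm /eqP md]; rewrite md ltnn in dm.
Qed.

Lemma grade_diff_pow_eq d x y :
  gr d x -> gr d y -> pow d.+1 (x - y) -> x = y.
Proof.
move=> dx dy /(grade_pow_eq0 (subspaceB (grade_subspace d) dx dy)) /eqP.
by rewrite subr_eq0 => /eqP.
Qed.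

(** A single family serves both quotients, so that dimensions of m^d / m^(d+1) can be computed with
    homogeneous elements. *)
Lemma basis_grade d : exists r (e : 'I_r -> A),
  basis_mod (gr d) [set 0] e /\ basis_mod (pow d) (pow d.+1) e.
Proof.
have ps := maxid_pow_subspace d.+1.
have [r [e [eg fe se]]] :=
  basis_mod_maxid_pow (gr d) ps (@subset_refl _ (pow d.+1)).
have es c : gr d (\sum_i c i *: e i).
  apply: (subspace_sum _ (grade_subspace d)) => i _.
  exact: (subspaceZ _ (grade_subspace d)).
exists r, e; split; split=> //.
- by move=> c /= c0; apply: fe; rewrite c0; case: ps.
- by move=> x dx; have [c /(grade_diff_pow_eq dx (es c)) ->] := se x dx;
    exists c; rewrite /= subrr.
- by move=> i; apply: grade_sub_pow.
- move=> x /maxid_pow_decomp[y dy xy]; have [c yc] := se y dy; exists c.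
  by rewrite -(subrK y x) -addrA; apply: (subspaceD ps).
Qed.

Lemma scaler_sum_mul (I : finType) l (c : I -> k) (e : I -> A) :
  \sum_i c i *: (l * e i) = l * \sum_i c i *: e i.
Proof. by rewrite mulr_sumr; apply: eq_bigr => i _; rewrite scalerAr. Qed.

(** By injectivity, multiplying a basis of [R]_1 by [l] gives a family in [R]_2 that is free modulo
    m^3; the dimension inequality makes it span. *)
Lemma mul_inj_surj l : gr 1 l -> set_inj (gr 1) ( *%R l) ->
  (dim_mod (pow 2) (pow 3) <= dim_mod (pow 1) (pow 2))%N ->
  set_surj (gr 1) (gr 2) ( *%R l).
Proof.
move=> l1 linj.
have [r [e [[eg fe _] eb]]] := basis_grade 1.
have [s [f [_ fb]]] := basis_grade 2.
rewrite (dim_modE (maxid_pow_subspace 3) fb).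
rewrite (dim_modE (maxid_pow_subspace 2) eb) => sr.
have es c : gr 1 (\sum_i c i *: e i).
  apply: (subspace_sum _ (grade_subspace 1)) => i _.
  exact: (subspaceZ _ (grade_subspace 1)).
have les c : gr 2 (l * \sum_i c i *: e i) by exact: (gradeM l1 (es c)).
have spans : pow 2 `<=` span_mod (pow 3) (fun i => l * e i).
  apply: (free_mod_spans (maxid_pow_subspace 3) fb) sr => [i|c].
    by apply: grade_sub_pow; apply: (gradeM l1 (eg i)).
  rewrite scaler_sum_mul => /(grade_pow_eq0 (les c)) lc0.
  apply: fe => /=; apply: linj; rewrite ?inE ?mulr0 //.
  by case: (grade_subspace 1).
move=> z z2; have [c] := spans z (grade_sub_pow z2).
rewrite scaler_sum_mul => /(grade_diff_pow_eq z2 (les c)) ->.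
by exists (\sum_i c i *: e i).
Qed.

(** Each ring element is a scalar plus an element of m, hence each multiple of [l] is a scalar
    multiple of [l] modulo m(l). *)
Lemma principal_ideal_dim l :
  (dim_mod (principal l)
     (ideal_mul maxid (principal l)) <= 1)%N.
Proof.
set I := principal l; have I0 := principal_ideal l.
have Ks : subspace (ideal_mul maxid I) by exact/ideal_subspace/smallest_ideal.
apply: (dim_mod_le (e := fun i : 'I_1 => l) Ks) => _ [x _ <-].
have x0 : pow 0 x by [].
have [y /grade0E[c ->] ] := maxid_pow_decomp x0.
rewrite maxid_pow1 => xc; exists (fun=> c).
rewrite big_ord1 -[l in c *: l]mulr1 scalerAr -mulrBr mulrC.
by apply: mem_ideal_mul => //; exists 1; rewrite ?mulr1.
Qed.

Lemma mul_surj_square_sub l : set_surj (gr 1) (gr 2) ( *%R l) ->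
  pow 2 `<=` (principal l).
Proof.
move=> lsurj; apply: grade_exp_sub_ideal; first exact: principal_ideal.
by move=> z /lsurj[x _ <-]; exists x.
Qed.

(** Induction on monomials: split off one variable, write the remaining monomial as a multiple of
    [l] by the induction hypothesis, and multiply back. *)
Lemma mul_surj_succ l i :
  set_surj (gr 1) (gr 2) ( *%R l) -> (0 < i)%N ->
  set_surj (gr i) (gr i.+1) ( *%R l).
Proof.
move=> lsurj; elim: i => [//|[//|i] IH] _.
apply: grade_sub_subspace => [|m dm].
  split=> [|c _ _ [x dx <-] [y dy <-]].
    by exists 0; rewrite /= ?mulr0 //; case: (grade_subspace i.+2).
  exists (c *: x + y); last by rewrite mulrDr scalerAr.
  by case: (grade_subspace i.+2) => _; apply.
have [m1 [m2 [-> d1 d2]]] := mnm_split (dm : _ = 1 + i.+2)%N.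
have [//|x dx lx] := IH isT (pi 'X_[m2]); first by rewrite -d2; apply: gradeX.
exists (pi 'X_[m1] * x); last by rewrite /= mulrCA lx piXD.
have x1 : gr 1 (pi 'X_[m1]) by rewrite -d1; apply: gradeX.
exact: (gradeM x1 dx).
Qed.

(** The [l]-multiples of a basis of [R]_i span m^(i+1) modulo m^(i+2). *)
Lemma dim_maxid_pow_le l i :
  gr 1 l -> set_surj (gr 1) (gr 2) ( *%R l) -> (0 < i)%N ->
  (dim_mod (pow i.+1) (pow i.+2) <= dim_mod (pow i) (pow i.+1))%N.
Proof.
move=> l1 lsurj i0.
have [r [e [[eg fe se] eb]]] := basis_grade i.
rewrite (dim_modE (maxid_pow_subspace i.+1) eb).
have ps := maxid_pow_subspace i.+2.
apply: (dim_mod_le (e := fun j => l * e j) ps).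
move=> x /maxid_pow_decomp[_ /(mul_surj_succ lsurj i0)[y dy <-] xy].
have [c /= /eqP] := se y dy; rewrite subr_eq0 => /eqP Ey.
by exists c; rewrite scaler_sum_mul -Ey.
Qed.

Lemma generator_of_square I :
    is_ideal I -> homogeneous (fun d => gr d) I ->
    I `<=` maxid -> pow 2 `<=` I -> (dim_mod I (ideal_mul maxid I) <= 1)%N ->
  exists2 l, gr 1 l & set_surj (gr 1) (gr 2) ( *%R l).
Proof.
move=> Ii Ihom Im I2 dimI.
set K := ideal_mul maxid I in dimI.
have Ks : subspace K by exact/ideal_subspace/smallest_ideal.
(* A power of m inside [K] ensures that I / mI has a finite basis, so that [dimI] does not come from
   the junk value of [dim_mod]. *)
have K3 : pow 3 `<=` K.
  apply: ideal_mul_sub; first exact: smallest_ideal.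
  by move=> x y mx /I2 Iy; apply: mem_ideal_mul.
have K2 : K `<=` pow 2.
  apply: ideal_mul_sub; first exact: ideal_exp_ideal.
  move=> x y mx /Im my; apply: mem_ideal_mul => //.
  by rewrite -[y]mulr1; apply: mem_ideal_mul.
(* Since I / mI has dimension at most 1, any element of [I] outside mI spans it. *)
have gen g : I g -> ~ K g -> forall x, I x -> exists c : k, K (x - c *: g).
  move=> Ig nKg x Ix.
  have [r [e eb]] := basis_mod_maxid_pow I Ks K3.
  have [c] : span_mod K (fun i : 'I_1 => g) x.
    apply: (free_mod_spans Ks eb) Ix => //.
      move=> c; rewrite big_ord1 => Kcg i; rewrite (ord1 i).
      apply/eqP/negPn/negP => c0; apply: nKg.
      by rewrite -[g](scalerK c0); apply: (subspaceZ _ Ks).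
    by rewrite -(dim_modE Ks eb).
  by rewrite big_ord1 => xg; exists (c ord0).
have p2s := maxid_pow_subspace 2; have p3s := maxid_pow_subspace 3.
(* If I lies in m^2 then I = m^2 and dim [R]_2 <= 1, so any nonzero product of
   two linear forms spans [R]_2.  Otherwise a linear form g of I outside m^2
   spans I modulo m I. *)
have [I1|/existsNP[x /not_implyP[Ix nx]]] := pselect (I `<=` pow 2).
  have K3E : K `<=` pow 3.
    apply: ideal_mul_sub; first exact: ideal_exp_ideal.
    by move=> x y mx /I1; apply: mem_ideal_mul.
  have [[l [l' [l1 l'1 ll']]]|none] :=
      pselect (exists l l', [/\ gr 1 l, gr 1 l' & l * l' != 0]).
    exists l => // z z2; have ll'2 := gradeM l1 l'1.
    have [||c /K3E zc] := gen (l * l') _ _ z (I2 _ (grade_sub_pow z2)).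
    - exact/I2/grade_sub_pow.
    - by move=> /K3E /(grade_pow_eq0 ll'2) /eqP; rewrite (negPf ll').
    exists (c *: l'); first exact: (subspaceZ _ (grade_subspace 1)).
    rewrite -scalerAr; apply: esym; apply: (grade_diff_pow_eq z2 _ zc).
    exact: (subspaceZ _ (grade_subspace 2)).
  (* All products of two linear forms vanish, so [R]_2 = 0 and the zero form is onto. *)
  exists 0; first by case: (grade_subspace 1).
  apply: grade_sub_subspace => [|m dm].
    split=> [|c _ _ [x dx <-] [y dy <-]].
      by exists 0; rewrite /= ?mulr0 //; case: (grade_subspace 1).
    by exists 0; rewrite /= ?mul0r ?scaler0 ?addr0 //; case: (grade_subspace 1).
  have [m1 [m2 [-> d1 d2]]] := mnm_split (dm : _ = 1 + 1)%N.
  exists 0; first by case: (grade_subspace 1).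
  rewrite /= mul0r piXD; apply/esym/eqP/negPn/negP => n0; apply: none.
  by exists (pi 'X_[m1]), (pi 'X_[m2]); split=> //;
    [rewrite -d1|rewrite -d2]; apply: gradeX.
(* Some homogeneous component of [x] lies outside m^2. Its degree is at most 1, and it is not 0
   because a component of degree 0 in m vanishes. *)
have [g [Ig g1 n2g]] : exists g, [/\ I g, gr 1 g & ~ pow 2 g].
  have [N [y [yP Ex]]] := Ihom x Ix.
  apply: contrapT => nog; apply: nx; rewrite Ex; apply: (subspace_sum _ p2s).
  move=> i _; have [dy Iy] := yP i.
  case: (ltnP 1 i) => [i2|].
    exact: (maxid_pow_le i2 (grade_sub_pow dy)).
  rewrite leq_eqVlt ltnS leqn0 => /orP[] /eqP i0; rewrite i0 in dy.
    by apply: contrapT => n2; apply: nog; exists (y i); split.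
  rewrite (grade_pow_eq0 dy); first by case: p2s.
  by rewrite maxid_pow1; apply: Im.
exists g => // z z2.
have genE u : I u -> exists c : k, pow 2 (u - c *: g) /\ K (u - c *: g).
  move=> /(gen g Ig (fun Kg => n2g (K2 _ Kg)))[c xc].
  by exists c; split=> //; apply: K2.
(* Write z = c g modulo mI, which lies in m^2. As [z] is in m^2 and [g] is not, c = 0. *)
have Kz : K z.
  have [c [_ zc]] := genE z (I2 _ (grade_sub_pow z2)).
  have [c0|c0] := eqVneq c 0; first by rewrite c0 scale0r subr0 in zc.
  case: n2g; rewrite -[g](scalerK c0); apply: (subspaceZ _ p2s).
  rewrite -[_ *: _](subKr z).
  by apply: (subspaceB p2s); [apply: grade_sub_pow|apply: K2].
(* It suffices to treat products u v with [u] in m and [v] in [I]: since v = c g modulo m^2, u v = g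
   (c u) modulo m^3. *)
have : exists2 y, maxid y & pow 3 (z - g * y).
  move: z Kz {z2}; apply: ideal_mul_sub.
    split=> [|a u v [x' mx' xx'] [y' my' yy']].
      by exists 0; [case: maxid_ideal|rewrite mulr0 subrr; case: p3s].
    exists (a * x' + y'); first by case: maxid_ideal => _; apply.
    rewrite mulrDr opprD addrACA mulrCA -mulrBr.
    by case: (ideal_exp_ideal maxid 3) => _; apply.
  move=> u v mu /genE[c [vc _]]; exists (c *: u).
    exact: (subspaceZ _ (ideal_subspace maxid_ideal) mu).
  rewrite -scalerAr scalerAl [_ *: g * u]mulrC -mulrBr.
  exact: mem_ideal_mul.
case=> y my zy; have y1 : pow 1 y by rewrite maxid_pow1.
have {y1}[y1 dy1 yy1] := maxid_pow_decomp y1.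
(* Replacing [y] by its linear part changes g y only within m^3, and two elements of [R]_2 congruent
   modulo m^3 are equal. *)
exists y1 => //; apply: esym.
apply: (grade_diff_pow_eq z2); first exact: (gradeM g1 dy1).
rewrite -(subrK (g * y) z) -addrA -mulrBr; apply: (subspaceD p3s) => //.
exact: (maxid_powM (grade_sub_pow g1) yy1).
Qed.

(** * Passing from one surjective linear form to an open set of them *)

Lemma mul_inj0 l : l != 0 -> set_inj (gr 0) ( *%R l).
Proof.
move=> l0 x y; rewrite !inE => /grade0E[c ->] /grade0E[c' ->].
rewrite -!scalerAr mulr1 => /eqP; rewrite -subr_eq0 -scalerBl scaler_eq0.
by rewrite (negPf l0) orbF subr_eq0 => /eqP ->.
Qed.

(** If l = 0 is onto, then [R]_2 = 0, so any nonzero linear form is onto as well. *)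
Lemma mul_surj_neq0 l : gr 1 l -> set_surj (gr 1) (gr 2) ( *%R l) ->
  exists l', [/\ gr 1 l', set_surj (gr 1) (gr 2) ( *%R l')
    & gr 1 `<=` [set 0] \/ l' != 0].
Proof.
move=> l1 lsurj; have [l0|l0] := eqVneq l 0; last first.
  by exists l; split=> //; right.
have [g0|/existsNP[x /not_implyP[x1 /eqP x0]]] := pselect (gr 1 `<=` [set 0]).
  by exists l; split=> //; left.
exists x; split=> //; last by right.
move=> z /lsurj[y _ <-]; exists 0; first by case: (grade_subspace 1).
by rewrite l0 mul0r mulr0.
Qed.

Lemma mul_surj_generic l : gr 1 l -> set_surj (gr 1) (gr 2) ( *%R l) ->
  exists U : set A, [/\ zariski_open (gr 1) U, U !=set0
    & forall l', U l' -> forall i, set_inj (gr i) ( *%R l') \/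
                                   set_surj (gr i) (gr i.+1) ( *%R l')].
Proof.
move=> l1 lsurj.
have {l l1 lsurj}[l [l1 lsurj lneq0]] := mul_surj_neq0 l1 lsurj.
have [r [e [be _]]] := basis_grade 1; have [eg fe se] := be.
have [s [f [[fg ff sf] _]]] := basis_grade 2.
have coord d N (h : 'I_N -> A) x : (forall x, gr d x -> span_mod [set 0] h x) ->
    gr d x -> exists c : 'I_N -> k, x = \sum_i c i *: h i.
  move=> sh /sh[c /= /eqP]; rewrite subr_eq0 => /eqP xc.
  by exists c.
have es (c : 'I_r -> k) : gr 1 (\sum_i c i *: e i).
  apply: (subspace_sum _ (grade_subspace 1)) => i _.
  exact: (subspaceZ _ (grade_subspace 1)).
have /choice[T TP] (ij : 'I_r * 'I_r) :
    exists c : 'I_s -> k, e ij.1 * e ij.2 = \sum_t c t *: f t.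
  exact/(coord 2 _ _ _ sf)/gradeM.
(* M a is the matrix of multiplication by \sum_i a i *: e i from [R]_1 to [R]_2,
   and B the matrix of a section of it at l; the open set is the locus where
   \det (B *m M a) does not vanish, cut by one coordinate to avoid 0. *)
pose Mx : 'M[{mpoly k[r]}]_(r, s) := \matrix_(j, t) \sum_i T (i, j) t *: 'X_i.
pose M (a : 'I_r -> k) : 'M[k]_(r, s) := \matrix_(j, t) \sum_i a i * T (i, j) t.
have MxE a : map_mx (meval a) Mx = M a.
  apply/matrixP => j t; rewrite !mxE rmorph_sum; apply: eq_bigr => i _ /=.
  by rewrite mevalZ mevalXU mulrC.
have mulE (a : 'I_r -> k) (u : 'rV[k]_r) :
    (\sum_i a i *: e i) * (\sum_j u 0 j *: e j) = \sum_t (u *m M a) 0 t *: f t.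
  rewrite mulr_sumr; under [RHS]eq_bigr do rewrite mxE scaler_suml.
  rewrite exchange_big; apply: eq_bigr => j _ /=.
  rewrite mulr_suml; under [RHS]eq_bigr do
    rewrite mxE mulr_sumr scaler_suml.
  rewrite exchange_big; apply: eq_bigr => i _ /=.
  rewrite -scalerAl -scalerAr (TP (i, j)) !scaler_sumr.
  by apply: eq_bigr => t _; rewrite !scalerA mulrCA mulrA.
have [a0 la0] := coord 1 _ _ _ se l1.
(* [b t] collects the coordinates of a preimage of [f t] under multiplication by [l]; these rows
   form the section [B]. *)
have /choice[b bP] t : exists u : 'rV[k]_r, f t = l * \sum_j u 0 j *: e j.
  have [x /(coord 1 _ _ _ se)[c ->] <-] := lsurj _ (fg t).
  by exists (\row_j c j); congr (_ * _); apply: eq_bigr => j _; rewrite mxE.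
pose B : 'M[k]_(s, r) := \matrix_t b t.
have BM1 : B *m M a0 = 1%:M.
  apply/row_matrixP => t; rewrite row_mul rowK row1.
  apply/rowP => t'; apply/eqP; rewrite -subr_eq0; apply/eqP.
  pose c t' := (b t *m M a0) 0 t' - (delta_mx 0 t : 'rV_s) 0 t'.
  apply: (ff c); rewrite /c /=.
  under eq_bigr do rewrite scalerBl.
  rewrite sumrB -mulE -la0 -bP (bigD1 t) //= big1 => [|t'' /negPf tt].
    by rewrite !mxE !eqxx scale1r addr0 subrr.
  by rewrite mxE tt andbF scale0r.
pose F := \det (map_mx (@mpolyC r k) B *m Mx).
have FE a : F.@[a] = \det (B *m M a).
  rewrite /F -[LHS](det_map_mx (meval a)) map_mxM MxE -map_mx_comp.
  congr (\det (_ *m _)); apply/matrixP => i j; rewrite !mxE /=.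
  by rewrite mevalC.
have [G [G0 GP]] : exists G : {mpoly k[r]}, G.@[a0] != 0 /\
    forall a, G.@[a] != 0 -> gr 1 `<=` [set 0] \/ \sum_i a i *: e i != 0.
  (* If [R]_1 = 0, every form is zero and the constant 1 imposes no condition. *)
  have [g0|ln0] := lneq0.
    by exists 1; rewrite meval1 oner_eq0; split=> // a _; left.
  have [j aj] : exists j, a0 j != 0.
    apply: contrapT => nj; move/eqP: ln0; apply; rewrite la0 big1 // => i _.
    have [->|ai] := eqVneq (a0 i) 0; first by rewrite scale0r.
    by case: nj; exists i.
  exists 'X_j; rewrite mevalXU; split=> // a; rewrite mevalXU => aj0; right.
  by apply/eqP => /fe /(_ j) /eqP; rewrite (negPf aj0).
exists [set x | exists2 a, x = \sum_i a i *: e i & (F * G).@[a] != 0].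
split.
- split; first by move=> _ [a -> _]; apply: es.
  exists r, e, [set F * G]; split=> // a.
  (* Linear independence of [e] identifies the coordinates [a'] stored in the set with the given
     [a]. *)
  split=> [[a' Ea Fa']|[_ -> Fa]]; last by exists a.
  exists (F * G) => //; suff -> : a = a' by [].
  apply: funext => i; apply/eqP; rewrite -subr_eq0; apply/eqP.
  apply: (fe (fun i => a i - a' i)) => /=.
  under eq_bigr do rewrite scalerBl.
  by rewrite sumrB Ea subrr.
- by exists l, a0 => //; rewrite mevalM mulf_neq0 // FE BM1 det1 oner_neq0.
- move=> _ [a ->]; rewrite mevalM mulf_eq0 negb_or FE => /andP[D0 /GP Ga] [|i].
    case: Ga => [g0|n0]; [right|by left; apply: mul_inj0].
    move=> x /g0 ->; exists 0; rewrite /= ?mulr0 //.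
    by case: (grade_subspace 0).
  right; apply: mul_surj_succ => // z /(coord 2 _ _ _ sf)[c ->].
  (* The matrix (B M)^-1 B is a left factor inverting M: the row [u] satisfies u M = c. *)
  pose u := (\row_t c t) *m invmx (B *m M a) *m B.
  exists (\sum_j u 0 j *: e j) => //.
  rewrite mulE -!mulmxA mulVmx ?unitmxE ?unitfE // mulmx1.
  by apply: eq_bigr => t _; rewrite mxE.
Qed.

(** * The two implications for a graded image *)

Local Notation num_gen I := (dim_mod I (ideal_mul maxid I)).
Local Notation admissible := [set I : set A |
  [/\ is_ideal I, homogeneous (fun d => gr d) I, I `<=` maxid & pow 2 `<=` I]].
Local Notation max_rank l i :=
  (set_inj (gr i) ( *%R l) \/ set_surj (gr i) (gr i.+1) ( *%R l)).
Local Notation min_gen := (min_nat [set num_gen I | I in admissible]).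
Local Notation lefschetz := (exists U : set A,
  [/\ zariski_open (gr 1) U, U !=set0
    & forall l, U l -> forall i, max_rank l i]).

Lemma principal_admissible l : gr 1 l -> set_surj (gr 1) (gr 2) ( *%R l) ->
  admissible (principal l).
Proof.
move=> l1 lsurj; split.
- exact: principal_ideal.
- exact: (principal_homogeneous l1).
- move=> _ [r _ <-]; rewrite mulrC; apply: (idealM _ maxid_ideal).
  by rewrite -maxid_pow1; apply: grade_sub_pow.
- exact: mul_surj_square_sub.
Qed.

(** Shows that the minimum is taken over a nonempty set, so that it is attained by some admissible
    ideal. *)
Lemma maxid_admissible : admissible maxid.
Proof.
split=> //; first exact: maxid_ideal.
  by have := maxid_pow_homogeneous (d := 1); rewrite maxid_pow1.
by have := maxid_pow_le (leqnSn 1); rewrite maxid_pow1.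
Qed.

Lemma lefschetz_square_principal :
  (lefschetz -> (num_gen (pow 2) <= num_gen maxid)%N -> (min_gen <= 1)%N) /\
  ((min_gen <= 1)%N -> lefschetz /\
     forall i, (1 <= i)%N -> (num_gen (pow i.+1) <= num_gen (pow i))%N).
Proof.
split.
  move=> [U [[U1 _] [l Ul] Umax]] mu2; have l1 := U1 l Ul.
  have lsurj : set_surj (gr 1) (gr 2) ( *%R l).
    case: (Umax l Ul 1) => // linj; apply: (mul_inj_surj l1 linj).
    (* By definition m m^d is m^(d+1), so [num_gen] of a power unfolds to the needed dimension; but
       m^1 unfolds to the product of m with the unit ideal and has to be rewritten. *)
    have E : num_gen (pow 1) = num_gen maxid by rewrite maxid_pow1.
    exact: leq_trans mu2 (eq_leq (esym E)).
  apply: leq_trans (principal_ideal_dim l).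
  have [//|_] := min_natP (P := [set num_gen I | I in admissible])
    (m := num_gen (principal l)).
    by exists (principal l) => //; apply: principal_admissible.
  by apply; exists (principal l) => //; apply: principal_admissible.
have [|[I [Ii Ihom Im I2] <-] _] := min_natP
    (P := [set num_gen I | I in admissible]) (m := num_gen maxid).
  by exists maxid => //; apply: maxid_admissible.
move=> /(generator_of_square Ii Ihom Im I2)[l l1 lsurj].
split; first exact: (mul_surj_generic l1 lsurj).
by move=> i i0; apply: (dim_maxid_pow_le l1 lsurj).
Qed.

End HomogeneousIdeal.

End GradedImage.

(** * The quotient map of the polynomial ring *)

Section QuotientMap.
Variables (k : fieldType) (n : nat) (J : idealr {mpoly k[n]}).
Local Notation pi := (\pi_({ideal_quot J}) : {mpoly k[n]} -> _).

Lemma pi_quot_scale c (p : {mpoly k[n]}) : pi (c *: p) = c *: pi p.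
Proof. by rewrite quot_scaleE. Qed.

Lemma pi_quot_surj x : exists p, pi p = x.
Proof. by exists (repr x); rewrite reprK. Qed.

Lemma pi_quot_eq0 p : pi p = 0 <-> p \in J.
Proof.
rewrite -[p in p \in J]subr0 Quotient.idealrBE rmorph0.
by split=> [->|/eqP].
Qed.

(** In a decomposition of [p] into homogeneous elements of [J], the projection to degree d keeps at
    most the summand of index d and kills the others. *)
Lemma pi_quot_pihomog : homogeneous (@poly_degree k n) [set p | p \in J] ->
  forall d p, pi p = 0 -> pi (pihomog mdeg d p) = 0.
Proof.
move=> Jhom d p /pi_quot_eq0/Jhom[N [y [yP ->]]]; apply/pi_quot_eq0.
rewrite linear_sum /=; apply: rpred_sum => i _; have [hy yJ] := yP i.
have [<-|id] := eqVneq (i : nat) d; first by rewrite pihomog_dE.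
by rewrite (pihomog_ne0 id hy) rpred0.
Qed.

End QuotientMap.

Theorem proposition4p7 (k : fieldType) (n : nat) (J : idealr {mpoly k[n]}) :
  infinite_set [set: k] ->
  homogeneous (@poly_degree k n) [set p | p \in J] ->
  artinian {ideal_quot J} ->
  (weak_lefschetz J ->
     (mu (ideal_exp (maxid J) 2) <= mu (maxid J))%N -> (ms J <= 1)%N) /\
  ((ms J <= 1)%N ->
     weak_lefschetz J /\
     forall i, (1 <= i)%N ->
       (mu (ideal_exp (maxid J) i.+1) <= mu (ideal_exp (maxid J) i))%N).
Proof.
move=> _ Jhom _.
exact: (lefschetz_square_principal (@pi_quot_scale k n J)
  (@pi_quot_surj k n J) (pi_quot_pihomog Jhom)).
Qed.
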